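(* Let $\Gamma$ be a finitely generated group and fix a word length function $|\cdot|_\Gamma:\Gamma\to\mathbb{N}$ on $\Gamma$. Suppose that there exists a Floyd function $f:\mathbb{N}\to(0,\infty)$ such that the Floyd boundary $\partial_f\Gamma$ of $\Gamma$ is non-trivial. Let $H$ be a torsion-free subgroup of $\Gamma$ whose limit set $\Lambda(H)$ in $\partial_f\Gamma$ contains at least three points. Then there exist a finite subset $F$ of $H$ and $C>0$, depending only on $H$, with the property: for every $\gamma\in H$ there exists $g\in F$ such that $$|g\gamma|_\Gamma-|g\gamma|_\infty\le C.$$ In particular, if $\Gamma$ is virtually torsion-free then it satisfies strong property (U).
   Context: $|\gamma|_\Gamma=d_\Gamma(\gamma,e)$ for the word metric of a finite generating set $S$, and $|\gamma|_\infty=\lim_n|\gamma^n|_\Gamma/n$ is the stable translation length. Floyd function: a non-increasing $f:\mathbb{N}\to(0,\infty)$ with $\sum_{n\ge1}f(n)<\infty$ for which there is $0<\epsilon<1$ with $\epsilon f(n)\le f(n+1)\le f(n)$ for all $n$. Floyd boundary: on $\Gamma$, give an edge of the Cayley graph (with respect to $S$) joining adjacent $g,h$ the length $f(\max\{|g|_\Gamma,|h|_\Gamma\})$, and let $d_f(g,h)$ be the infimum of the lengths of edge paths from $g$ to $h$. If $\overline\Gamma$ is the metric completion of $(\Gamma,d_f)$, then $\partial_f\Gamma=\overline\Gamma\smallsetminus\Gamma$. It is non-trivial if it contains at least three points. The limit set $\Lambda(H)\subset\partial_f\Gamma$ of a subgroup $H$ is the set of accumulation points in $\partial_f\Gamma$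 of infinite sequences of elements of $H$. Strong property (U): there exist a finite subset $F\subset\Gamma$ and $C,c>0$ such that for every $\gamma\in\Gamma$ there is $w\in F$ with $|w\gamma|_\infty\ge c|\gamma|_\Gamma-C$. *)

(* Defs.v *)
From HB Require Import structures.
From mathcomp Require Import all_boot all_order all_algebra.
From mathcomp Require Import all_classical all_reals all_analysis.
From mathcomp Require Import finmap lra.

Set Implicit Arguments.
Unset Strict Implicit.
Unset Printing Implicit Defensive.

Import Order.TTheory GRing.Theory Num.Theory.
Import numFieldNormedType.Exports.

Local Open Scope classical_set_scope.
Local Open Scope ring_scope.
Local Open Scope quotient_scope.

Lemma cauchy_seqP (R : realType) (T : metricType R) (u : nat -> T) :
  cauchy (u @ \oo) <->
  forall e : R, 0 < e -> exists N, forall m n, (N <= m)%N -> (N <= n)%N ->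
    mdist (u m) (u n) < e.
Proof.
split.
- move/cauchy_ballP => cu e e0.
  have [[A B] /= [[N _ NA] [M _ MB]] AB] := cu _ e0.
  exists (maxn N M) => m n; rewrite !geq_max => /andP[Nm _] /andP[_ Mn].
  have := AB (u m, u n); rewrite /= ballEmdist/=; apply.
  by split; [exact: NA | exact: MB].
- move=> cu; apply/cauchy_ballP => e e0.
  have [N HN] := cu _ e0.
  exists (u @` [set n | (N <= n)%N], u @` [set n | (N <= n)%N]) => /=.
    by split; exists N => // n Nn; exists n.
  by case=> x y [[m Nm /= <-] [n Nn /= <-]]; rewrite ballEmdist; exact: HN.
Qed.

(* The completion of a metric space, as the quotient of its Cauchy sequences
   by the relation "the mutual distance tends to 0". *)
Section Completion.
Context {R : realType} (T : metricType R).

Definition cauchy_sequence := {u : nat -> T | `[< cauchy (u @ \oo) >]}.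

Implicit Types u v w : cauchy_sequence.

Lemma ler_mdist (x x' y y' : T) :
  `|mdist x y - mdist x' y'| <= mdist x x' + mdist y y'.
Proof.
have H (a a' b b' : T) : mdist a b - mdist a' b' <= mdist a a' + mdist b b'.
  rewrite lerBlDr (le_trans (metric_triangle a a' b))// -addrA lerD2l.
  by rewrite addrC (metric_sym b b') metric_triangle.
rewrite ler_norml H andbT lerNl opprB (le_trans (H _ _ _ _))//.
by rewrite (metric_sym x') (metric_sym y').
Qed.

Lemma is_cvg_mdist u v : cvgn (fun n => mdist (sval u n) (sval v n)).
Proof.
have /asboolP/cauchy_seqP cu := svalP u.
have /asboolP/cauchy_seqP cv := svalP v.
apply/cauchy_cvgP/cauchy_ballP => e e0.
have e20 : 0 < e / 2 by rewrite divr_gt0.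
have [N HN] := cu _ e20; have [M HM] := cv _ e20 => /=.
pose D := [set mdist (sval u n) (sval v n) | n in [set n | (maxn N M <= n)%N]].
exists (D, D) => /=; first by split; exists (maxn N M) => // n Nn; exists n.
case=> _ _ [[m /= + <-] [n /= + <-]]; rewrite !geq_max.
move=> /andP[Nm Mm] /andP[Nn Mn].
rewrite /ball/= (le_lt_trans (ler_mdist _ _ _ _))// (splitr e).
by rewrite ltrD// ?HN ?HM.
Qed.

Definition cauchy_dist u v : R :=
  limn (fun n => mdist (sval u n) (sval v n)).

Lemma cauchy_distxx u : cauchy_dist u u = 0.
Proof.
by rewrite /cauchy_dist; under eq_fun do rewrite mdistxx; rewrite lim_cst.
Qed.

Lemma cauchy_dist_sym u v : cauchy_dist u v = cauchy_dist v u.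
Proof. by rewrite /cauchy_dist; under eq_fun do rewrite metric_sym. Qed.

Lemma cauchy_dist_triangle v u w :
  cauchy_dist u w <= cauchy_dist u v + cauchy_dist v w.
Proof.
rewrite /cauchy_dist -limD; try exact: is_cvg_mdist.
apply: ler_lim; [exact: is_cvg_mdist| |].
  by apply: is_cvgD; exact: is_cvg_mdist.
by apply: nearW => n; exact: metric_triangle.
Qed.

Lemma cauchy_dist_ge0 u v : 0 <= cauchy_dist u v.
Proof.
apply: limr_ge; first exact: is_cvg_mdist.
by apply: nearW => n; exact: mdist_ge0.
Qed.

Definition cauchy_equiv u v : bool := cauchy_dist u v == 0.

Lemma cauchy_equiv_refl : reflexive cauchy_equiv.
Proof. by move=> u; rewrite /cauchy_equiv cauchy_distxx. Qed.

Lemma cauchy_equiv_sym : symmetric cauchy_equiv.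
Proof. by move=> u v; rewrite /cauchy_equiv cauchy_dist_sym. Qed.

Lemma cauchy_equiv_trans : transitive cauchy_equiv.
Proof.
move=> v u w /eqP uv /eqP vw; rewrite /cauchy_equiv eq_le cauchy_dist_ge0 andbT.
by rewrite (le_trans (cauchy_dist_triangle v _ _))// uv vw addr0.
Qed.

Canonical cauchy_equiv_rel :=
  EquivRel cauchy_equiv cauchy_equiv_refl cauchy_equiv_sym cauchy_equiv_trans.

Definition completion := {eq_quot cauchy_equiv_rel}.

HB.instance Definition _ := Choice.on completion.

Definition completion_dist (x y : completion) : R :=
  cauchy_dist (repr x) (repr y).

Let distxx x : completion_dist x x = 0.
Proof. exact: cauchy_distxx. Qed.

Let dist_positivity x y : completion_dist x y = 0 -> x = y.
Proof.
by move=> /eqP xy; rewrite -[x]reprK -[y]reprK; apply/eqmodP.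
Qed.

Let dist_sym x y : completion_dist x y = completion_dist y x.
Proof. exact: cauchy_dist_sym. Qed.

Let dist_triangle y x z :
  completion_dist x z <= completion_dist x y + completion_dist y z.
Proof. exact: cauchy_dist_triangle. Qed.

HB.instance Definition _ := isMetric.Build R completion
  distxx dist_positivity dist_sym dist_triangle.

Lemma cauchy_cst (x : T) : `[< cauchy ((fun=> x) @ \oo : set_system T) >].
Proof.
apply/asboolP/cauchy_seqP => e e0.
by exists 0 => m n _ _; rewrite mdistxx.
Qed.

Definition to_completion (x : T) : completion :=
  \pi_completion (exist _ (fun=> x) (cauchy_cst x) : cauchy_sequence).

Lemma mdist_pi u v :
  mdist (\pi_completion u : completion) (\pi_completion v) = cauchy_dist u v.
Proof.
have dr w : cauchy_dist (repr (\pi_completion w)) w = 0.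
  by apply/eqP; have /eqmodP := reprK (\pi_completion w).
have le2 a b c d : cauchy_dist a b <=
    cauchy_dist a c + (cauchy_dist c d + cauchy_dist d b).
  by rewrite (le_trans (cauchy_dist_triangle c _ _))// lerD2l
    cauchy_dist_triangle.
set u' := repr (\pi_completion u); set v' := repr (\pi_completion v).
rewrite [LHS]/(cauchy_dist u' v').
have := le2 u v u' v'; have := le2 u' v' u v.
rewrite (cauchy_dist_sym u u') (cauchy_dist_sym v v') !dr !add0r !addr0.
by move=> h1 h2; apply/eqP; rewrite eq_le h1 h2.
Qed.

Lemma mdist_to_completion x y :
  mdist (to_completion x) (to_completion y) = mdist x y.
Proof. by rewrite mdist_pi /cauchy_dist/= lim_cst. Qed.

Lemma cvg_to_completion u :
  to_completion (sval u n) @[n --> \oo] --> (\pi_completion u : completion).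
Proof.
have /asboolP/cauchy_seqP cu := svalP u.
apply/metricType_numDomainType.cvgrPdist_le => e e0.
have [N HN] := cu _ e0; exists N => // m /= Nm.
rewrite mdist_pi; apply: limr_le; first exact: is_cvg_mdist.
by exists N => // n /= Nn; rewrite ltW// HN.
Qed.

Lemma dense_to_completion : dense (range to_completion).
Proof.
move=> O [x Ox] oO.
have /= := @cvg_to_completion (repr x); rewrite reprK => xl.
have /xl[N _ HN] : nbhs x O by apply: open_nbhs_nbhs; split.
exists (to_completion (sval (repr x) N)).
split; last by exists (sval (repr x) N).
by apply: HN => /=.
Qed.

Lemma complete_completion (F : nat -> completion) :
  cauchy (F @ \oo) -> exists l : completion, F @ \oo --> l.
Proof.
move=> /cauchy_seqP cF.
have small (e : R) : 0 < e -> exists N : nat, forall n, (N <= n)%N ->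
    n.+1%:R^-1 < e.
  move=> e0; have [N _ HN] := near_infty_natSinv_lt (PosNum e0).
  by exists N => n Nn; exact: (HN n Nn).
have /choice[x Hx] n : exists t : T, mdist (F n) (to_completion t) < n.+1%:R^-1.
  have := @cvg_to_completion (repr (F n)); rewrite reprK.
  move=> /metricType_numDomainType.cvgrPdist_lt/(_ n.+1%:R^-1).
  rewrite invr_gt0 ltr0Sn => /(_ isT)[N _ /(_ N)/= HN].
  by eexists; apply: HN.
have cx : `[< cauchy (x @ \oo) >].
  apply/asboolP/cauchy_seqP => e e0.
  have e30 : 0 < e / 3 by rewrite divr_gt0.
  have [N HN] := cF _ e30; have [M HM] := small _ e30.
  exists (maxn N M) => m n; rewrite !geq_max => /andP[Nm Mm] /andP[Nn Mn].
  rewrite -mdist_to_completion (le_lt_trans (metric_triangle _ (F m) _))//.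
  have := metric_triangle (F m) (F n) (to_completion (x n)).
  have := lt_trans (Hx m) (HM _ Mm); have := lt_trans (Hx n) (HM _ Mn).
  have := HN _ _ Nm Nn; rewrite (metric_sym (to_completion _) (F m)); lra.
exists (\pi_completion (exist _ x cx : cauchy_sequence)).
apply/metricType_numDomainType.cvgrPdist_lt => e e0.
have e20 : 0 < e / 2 by rewrite divr_gt0.
have [M HM] := small _ e20.
have /metricType_numDomainType.cvgrPdist_lt/(_ _ e20)[N _ HN] :=
  @cvg_to_completion (exist _ x cx).
exists (maxn N M) => // n /=; rewrite geq_max => /andP[Nn Mn].
rewrite (le_lt_trans (metric_triangle _ (to_completion (x n)) _))//.
have := HN n Nn; have := lt_trans (Hx n) (HM _ Mn).
rewrite (metric_sym (F n)) /=; lra.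
Qed.

End Completion.

Section WordLength.
Context {G : groupType} (S : {fset G}).
Local Open Scope group_scope.

Definition is_word (w : seq G) : bool :=
  all (fun s => (s \in S) || (s^-1 \in S)) w.

Definition generates : Prop :=
  forall g : G, exists2 w : seq G, is_word w & \prod_(s <- w) s = g.

Definition has_word_of_size (g : G) : pred nat :=
  fun n => `[< exists w : seq G, [/\ is_word w, \prod_(s <- w) s = g
                                   & size w = n] >].

(* The value 0 of the second branch is never used when S generates G. *)
Definition word_length (g : G) : nat :=
  if pselect (exists n, has_word_of_size g n) is left gn then ex_minn gn
  else 0%N.

Definition adjacent : rel G :=
  fun g h => (g^-1 * h \in S) || (h^-1 * g \in S).

Lemma word_lengthP (genS : generates) (g : G) :
  exists w, [/\ is_word w, \prod_(s <- w) s = g & size w = word_length g].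
Proof.
rewrite /word_length; case: pselect => [gn|[]].
  by case: ex_minnP => n /asboolP.
by have [w ww wg] := genS g; exists (size w); apply/asboolP; exists w.
Qed.

Lemma word_length_le (w : seq G) :
  is_word w -> (word_length (\prod_(s <- w) s) <= size w)%N.
Proof.
move=> ww; rewrite /word_length; case: pselect => // gn.
by case: ex_minnP => n _; apply; apply/asboolP; exists w.
Qed.

Lemma adjacent_sym : symmetric adjacent.
Proof. by move=> g h; rewrite /adjacent orbC. Qed.

Lemma is_word1_adjacent (g h : G) : adjacent g h = is_word [:: g^-1 * h].
Proof. by rewrite /= andbT invgM invgK. Qed.

Lemma adjacent_word_length (genS : generates) (g h : G) :
  adjacent g h -> (word_length h <= (word_length g).+1)%N.
Proof.
rewrite is_word1_adjacent => gh; have [w [ww wg <-]] := word_lengthP genS g.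
have -> : h = \prod_(s <- w ++ [:: g^-1 * h]) s.
  by rewrite big_cat big_seq1 wg /= mulVKg.
rewrite (leq_trans (word_length_le _)) ?size_cat ?addn1//.
by rewrite /is_word all_cat; apply/andP; split.
Qed.

Lemma adjacent_path (genS : generates) (g h : G) :
  exists2 p, path adjacent g p & last g p = h.
Proof.
have [w ww wgh] := genS (g^-1 * h).
have {wgh}-> : h = g * \prod_(s <- w) s by rewrite wgh mulVKg.
elim: w g ww => [|s w IHw] g; first by exists [::]; rewrite ?big_nil ?mulg1.
move=> /= /andP[sS ww]; have [p gp lp] := IHw (g * s) ww.
exists (g * s :: p); last by rewrite big_cons mulgA.
by rewrite /= gp andbT is_word1_adjacent mulKg /= sS.
Qed.

End WordLength.

Section FloydMetric.
Context {R : realType} {G : groupType} (S : {fset G}) (f : nat -> R).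

Definition floyd_function : Prop :=
  [/\ forall n, 0 < f n,
      nonincreasing_seq f,
      (\sum_(1 <= n <oo) (f n)%:E < +oo)%E
    & exists2 eps : R, 0 < eps < 1 & forall n, eps * f n <= f n.+1 <= f n].

Definition edge_length (g h : G) : R :=
  f (maxn (word_length S g) (word_length S h)).

Definition path_length (g : G) (p : seq G) : R :=
  \sum_(l <- pairmap edge_length g p) l.

Definition floyd_dist (g h : G) : R :=
  inf [set path_length g p |
       p in [set p | path (adjacent S) g p /\ last g p = h]].

Hypotheses (genS : generates S) (ff : floyd_function).

Let f_gt0 n : 0 < f n. Proof. by case: ff. Qed.

Let lengths g h := [set path_length g p |
       p in [set p | path (adjacent S) g p /\ last g p = h]].

Let path_length_cons g h p :
  path_length g (h :: p) = edge_length g h + path_length h p.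
Proof. by rewrite /path_length /= big_cons. Qed.

Let path_length_cat g p q :
  path_length g (p ++ q) = path_length g p + path_length (last g p) q.
Proof. by rewrite /path_length pairmap_cat big_cat. Qed.

Let path_length_ge0 g p : 0 <= path_length g p.
Proof.
elim: p g => [|h p IHp] g; first by rewrite /path_length big_nil.
by rewrite path_length_cons addr_ge0 // ltW // f_gt0.
Qed.

Let lengths_neq0 g h : lengths g h !=set0.
Proof.
by have [p gp ph] := adjacent_path genS g h; exists (path_length g p), p.
Qed.

Let lengths_lb0 g h : lbound (lengths g h) 0.
Proof. by move=> _ [p _ <-]; exact: path_length_ge0. Qed.

Let has_inf_lengths g h : has_inf (lengths g h).
Proof. by split; [exact: lengths_neq0|exists 0; exact: lengths_lb0]. Qed.

Lemma floyd_distxx g : floyd_dist g g = 0.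
Proof.
apply/eqP; rewrite eq_le; apply/andP; split.
  apply: ge_inf; first by exists 0; exact: lengths_lb0.
  by exists [::] => //; rewrite /path_length big_nil.
apply: lb_le_inf; [exact: lengths_neq0|exact: lengths_lb0].
Qed.

Lemma floyd_dist_ge_edge g h : g != h ->
  f (word_length S g).+1 <= floyd_dist g h.
Proof.
move=> gh; apply: lb_le_inf => [|_ [[|k p] [/= gp ph] <-]].
- exact: lengths_neq0.
- by rewrite ph eqxx in gh.
- have [_ f_dec _ _] := ff; have /andP[gk _] := gp.
  rewrite path_length_cons ler_wpDr ?path_length_ge0// f_dec//.
  by rewrite geq_max leqnSn (adjacent_word_length genS).
Qed.

Lemma floyd_dist_positivity g h : floyd_dist g h = 0 -> g = h.
Proof.
move=> gh; apply/eqP/negPn/negP => /floyd_dist_ge_edge.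
by rewrite gh leNgt f_gt0.
Qed.

Lemma floyd_dist_sym g h : floyd_dist g h = floyd_dist h g.
Proof.
rewrite /floyd_dist; congr inf.
have rv a b : lengths a b `<=` lengths b a.
  move=> _ [p [ap pb] <-]; elim: p a ap pb => [|k p IHp] a /=.
    by move=> _ <-; exists [::] => //; rewrite /path_length !big_nil.
  move=> /andP[ak kp] pb; have [q [bq qk] qp] := IHp _ kp pb.
  exists (rcons q a).
    by rewrite /= rcons_path bq last_rcons qk adjacent_sym.
  rewrite -cats1 path_length_cat path_length_cons qk path_length_cons qp.
  by rewrite /path_length /= big_nil addr0 addrC /edge_length maxnC.
by apply/seteqP; split; exact: rv.
Qed.

Lemma floyd_dist_triangle h g k :
  floyd_dist g k <= floyd_dist g h + floyd_dist h k.
Proof.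
apply/ler_addgt0Pr => e e0; have e20 : 0 < e / 2 by rewrite divr_gt0.
have [_ [p [gp ph] <-] pe] := inf_adherent e20 (has_inf_lengths g h).
have [_ [q [hq qk] <-] qe] := inf_adherent e20 (has_inf_lengths h k).
have : floyd_dist g k <= path_length g (p ++ q).
  apply: ge_inf; first by exists 0; exact: lengths_lb0.
  by exists (p ++ q) => //=; rewrite cat_path last_cat gp ph hq.
rewrite path_length_cat ph; move: pe qe.
rewrite -/(floyd_dist g h) -/(floyd_dist h k); lra.
Qed.

End FloydMetric.

(* The group as a metric space for the Floyd distance; the two proofs are
   parameters because the metric axioms need them. *)
Definition floyd_space (R : realType) (G : groupType) (S : {fset G})
  (f : nat -> R) of generates S & floyd_function f : Type := G.

Section FloydBoundary.
Context {R : realType} {G : groupType} {S : {fset G}} {f : nat -> R}.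
Variables (genS : generates S) (ff : floyd_function f).

HB.instance Definition _ := Choice.on (floyd_space genS ff).

HB.instance Definition _ := isMetric.Build R (floyd_space genS ff)
  (floyd_distxx genS ff) (floyd_dist_positivity genS ff)
  (floyd_dist_sym S f) (floyd_dist_triangle genS ff).

Definition floyd_completion := completion (floyd_space genS ff).

Definition to_floyd_completion (g : G) : floyd_completion :=
  to_completion (g : floyd_space genS ff).

Definition floyd_boundary : set floyd_completion :=
  ~` range to_floyd_completion.

(* The points of the boundary are not in G and the points of G are isolated,
   so a sequence that accumulates at one takes infinitely many values. *)
Definition limit_set (H : {pred G}) : set floyd_completion :=
  [set xi | floyd_boundary xi /\
     exists2 u : nat -> G, forall n, u n \in H &
       cluster (to_floyd_completion \o u @ \oo) xi].

End FloydBoundary.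

Arguments floyd_boundary {R G S f} genS ff.
Arguments limit_set {R G S f} genS ff H.

Section GroupProperties.
Context {G : groupType}.
Local Open Scope group_scope.

Definition torsion_free (H : {pred G}) : Prop :=
  {in H, forall g n, (0 < n)%N -> g ^+ n = 1 -> g = 1}.

Definition finite_index (H : {pred G}) : Prop :=
  exists T : {fset G}, forall g, exists2 t, t \in T & t^-1 * g \in H.

Definition virtually_torsion_free : Prop :=
  exists H : groupClosed G, torsion_free H /\ finite_index H.

End GroupProperties.

Arguments virtually_torsion_free : clear implicits.

Section StableLength.
Context (R : realType) {G : groupType} (S : {fset G}).

(* At n = 0 the quotient is 0 / 0 = 0, which does not affect the limit. *)
Definition stable_length (g : G) : R :=
  limn (fun n => (word_length S (g ^+ n)%g)%:R / n%:R : R).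

Definition strong_property_U : Prop :=
  exists (F : {fset G}) (C c : R), [/\ 0 < C, 0 < c &
    forall g : G, exists2 w, w \in F &
      c * (word_length S g)%:R - C <= stable_length (w * g)%g].

End StableLength.

(* Main.v *)
(* The Floyd distance d contracts far from 1: a geodesic that avoids a large
   ball around 1 is d-short (Karlsson).  Hence if x is long and y is d-far from
   x^-1, then x * y is d-close to x.  Applied inductively to powers, this shows
   that when d(x, x^-1) >= e all the positive powers of x stay d-close to x, so
   |x^(n+1)| >= |x^n| + |x| - C, with C = C(e), and |x| - |x|_oo <= C.

   It remains to find a finite F in H such that for each g in H some h in F
   makes h g and (h g)^-1 d-apart.  Take F = {x, y, z}, long, with x, y, z
   pairwise d-apart and x^-1, y^-1, z^-1 pairwise d-apart: g is close to at most
   one of the inverses; if it is far from x^-1 and y^-1, then xg ~ x,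
   (xg)^-1 ~ g^-1 ~ (yg)^-1 and yg ~ y, so x or y works.  Such triples come from
   two elements of H with north-south dynamics and four distinct ends: take g
   with d(g^i, g^-j) bounded below, and a conjugate of g by an element of H that
   is far from both ends of g.  If g and h share one end, the powers of h stay
   near those of g, so by pigeonhole h^s = g^t with s, t > 0, and they share the
   other end too.

   The second part is the same argument for H the whole group, whose limit set
   is the whole boundary. *)
From HB Require Import structures.
Require Import Defs.
From mathcomp Require Import all_boot all_order all_algebra.
From mathcomp Require Import all_classical all_reals all_analysis.
From mathcomp Require Import finmap zify lra.

Set Implicit Arguments.
Unset Strict Implicit.
Unset Printing Implicit Defensive.

Import Order.TTheory GRing.Theory Num.Theory.
Import numFieldNormedType.Exports.

Local Open Scope classical_set_scope.
Local Open Scope ring_scope.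

(** * Word metric and geodesics *)

Section WordMetric.
Context {G : groupType} {S : {fset G}} (genS : generates S).
Local Notation len := (word_length S).

Lemma word_length1 : len 1 = 0%N.
Proof. by have := @word_length_le G S [::] isT; rewrite big_nil leqn0 => /eqP. Qed.

Lemma word_lengthM x y : (len (x * y) <= len x + len y)%N.
Proof.
have [v [wv <- <-]] := word_lengthP genS x.
have [w [ww <- <-]] := word_lengthP genS y.
rewrite -size_cat -big_cat word_length_le// /is_word all_cat.
by apply/andP.
Qed.

Lemma word_lengthV x : len x^-1 = len x.
Proof.
have le y : (len y^-1 <= len y)%N.
  have [w [ww <- <-]] := word_lengthP genS y.
  elim: w ww => [|s w IH]; first by rewrite big_nil invg1 word_length1.
  move=> /= /andP[sS /IH {}IH]; rewrite big_cons invgM.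
  rewrite (leq_trans (word_lengthM _ _))// -addn1 leq_add//.
  have := @word_length_le G S [:: s^-1%g]; rewrite big_seq1; apply.
  by rewrite /is_word /= invgK orbC sS.
by apply/eqP; rewrite eqn_leq le /= -{1}(invgK x) le.
Qed.

Lemma word_length_triangle y x z :
  (len (x^-1 * z) <= len (x^-1 * y) + len (y^-1 * z))%N.
Proof. by rewrite -{1}[z](mulVKg y) mulgA word_lengthM. Qed.

Lemma word_length_sym x y : len (x^-1 * y) = len (y^-1 * x).
Proof. by rewrite -word_lengthV invgM invgK. Qed.

Lemma word_length_lip x y : (len x <= len y + len (x^-1 * y))%N.
Proof.
have := word_lengthM y (y^-1 * x); rewrite mulVKg => /leq_trans; apply.
by rewrite word_length_sym.
Qed.

Lemma word_length1_adjacent x y :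
  len (x^-1 * y) = 1%N -> Defs.adjacent S x y.
Proof.
have [w [ws wE <-]] := word_lengthP genS (x^-1 * y).
case: w ws wE => [|s [|t w]]//= ws wE _.
by rewrite is_word1_adjacent -wE big_seq1; exact: ws.
Qed.

Lemma finite_word_ball n : finite_set [set x | (len x <= n)%N].
Proof.
elim: n => [|n IH].
  apply: (@sub_finite_set _ _ [set 1%g]) => // x /=.
  rewrite leqn0 => /eqP lx.
  have [w [_ wx]] := word_lengthP genS x.
  by rewrite lx -wx => /size0nil ->; rewrite big_nil.
pose A := [set` S] `|` [set (s^-1)%g | s in [set` S]].
apply: (@sub_finite_set _ _
  ([set 1%g] `|` [set (s * x)%g | s in A & x in [set x | (len x <= n)%N]])).
  move=> x /=; have [[|s w] [ww <- <-]] := word_lengthP genS x.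
    by rewrite big_nil; left.
  move: ww => /= /andP[sS ww]; rewrite ltnS => wn; right.
  exists s; last exists (\prod_(s <- w) s)%g; rewrite ?big_cons//.
    by move: sS => /orP[?|?]; [left|right; exists s^-1%g; rewrite ?invgK].
  by apply: leq_trans wn => /=; exact: word_length_le.
rewrite finite_setU; split=> //; apply: finite_image2 => //.
by rewrite finite_setU; split; [|apply: finite_image]; exact: finite_fset.
Qed.

(** Values beyond [T] are unconstrained, so translates, subpaths and reversals are again plain
    functions on [nat]. *)
Definition geodesic (T : nat) (c : nat -> G) : Prop :=
  forall i j, (i <= j <= T)%N -> len ((c i)^-1 * c j) = (j - i)%N.

Lemma geodesic_mul T c x : geodesic T c -> geodesic T (fun i => x * c i)%g.
Proof. by move=> gc i j ij; rewrite invgM mulgA mulgVK gc. Qed.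

Lemma geodesic_sub T c a b : (a + b <= T)%N ->
  geodesic T c -> geodesic b (fun i => c (a + i)%N).
Proof. by move=> abT gc i j ij; rewrite gc; lia. Qed.

Lemma geodesic_rev T c a : (a <= T)%N ->
  geodesic T c -> geodesic a (fun i => c (a - i)%N).
Proof. by move=> aT gc i j ij; rewrite word_length_sym gc; lia. Qed.

(** The vertices are [x] times the prefixes of a shortest word. Each piece is at most as long as its
    number of letters, and the total length forces equality. *)
Lemma geodesic_exists x y : exists c,
  [/\ geodesic (len (x^-1 * y)) c, c 0%N = x & c (len (x^-1 * y)) = y].
Proof.
have [w [ww wxy wl]] := word_lengthP genS (x^-1 * y).
have pE (s : seq G) : is_word S s -> (len (\prod_(a <- s) a) <= size s)%N.
  exact: word_length_le.
pose c i := (x * \prod_(s <- take i w) s)%g; exists c; split; last 2 first.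
- by rewrite /c take0 big_nil mulg1.
- by rewrite /c -wl take_size wxy mulVKg.
rewrite -wl => i j /andP[ij jT].
have cE a b : (a <= b)%N ->
    ((c a)^-1 * c b = \prod_(s <- take (b - a) (drop a w)) s)%g.
  move=> ab; rewrite /c invgM mulgA mulgVK.
  have -> : take b w = take a w ++ take (b - a) (drop a w).
    by rewrite -takeD subnKC.
  by rewrite big_cat mulKg.
have le a b : (a <= b)%N -> (len ((c a)^-1 * c b) <= b - a)%N.
  move=> ab; rewrite cE// (leq_trans (pE _ _)) ?size_take_min ?geq_minl//.
  by apply/allP => s /mem_take /mem_drop; move/allP : ww => /[apply].
have := le _ _ ij; have := le 0%N i isT; have := le _ _ jT.
have := word_length_triangle (c i) (c 0%N) (c (size w)).
have := word_length_triangle (c j) (c i) (c (size w)).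
have -> : len ((c 0%N)^-1 * c (size w)) = size w.
  by rewrite cE// subn0 drop0 take_size wxy wl.
lia.
Qed.

End WordMetric.

Arguments geodesic {G} S T c.

(** * Floyd functions *)

Section FloydFunction.
Context {R : realType} {f : nat -> R} (ff : floyd_function f).

Lemma floyd_function_gt0 n : 0 < f n. Proof. by case: ff. Qed.

Lemma floyd_function_le m n : (m <= n)%N -> f n <= f m.
Proof. by case: ff => _ f_dec _ _; apply: f_dec. Qed.

Lemma floyd_function_tail e : 0 < e ->
  exists s, forall n, \sum_(s <= k < n) f k <= e.
Proof.
move=> e0; case: ff => f0 _ fsum _.
have fge0 n : (1 <= n)%N -> (fun=> true) n -> (0 <= (f n)%:E)%E.
  by move=> _ _; rewrite lee_fin ltW.
pose A := [set \sum_(1 <= k < n) f k | n in [set: nat]].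
have supA : has_sup A.
  split; first by exists (\sum_(1 <= k < 0) f k), 0%N.
  exists (fine (\sum_(1 <= n <oo) (f n)%:E)%E) => _ [n _ <-].
  rewrite -lee_fin fineK; last by rewrite ge0_fin_numE// nneseries_ge0.
  by rewrite -sumEFin; apply: nneseries_lim_ge.
have [_ [n _ <-] nsup] := sup_adherent e0 supA.
exists n.+1 => m; have [mn|nm] := leqP m n.
  by rewrite big_geq ?ltW// leqW.
have : \sum_(1 <= k < m) f k <= sup A by apply: sup_upper_bound => //; exists m.
have [n0|n0] := posnP n.
  rewrite n0 in nsup nm *; rewrite big_geq// in nsup; lra.
rewrite (@big_cat_nat _ _ _ n) ?(ltnW nm)//= (big_ltn nm) => /=.
have := f0 n; lra.
Qed.

(** With [r] twice a tail index [s], monotonicity bounds the constant part [r * f r] by twice the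
    sum of [f] from [s] to [r]; what remains is a tail. *)
Lemma floyd_function_cutoff e : 0 < e ->
  exists r, forall n, \sum_(k < n) f (maxn r k) <= e.
Proof.
move=> e0; have e30 : 0 < e / 3 by rewrite divr_gt0.
have [s sP] := floyd_function_tail e30.
exists s.*2 => n; rewrite -(big_mkord xpredT (fun k => f (maxn s.*2 k))).
apply: (@le_trans _ _ (\sum_(0 <= k < s.*2 + n) f (maxn s.*2 k))).
  rewrite [leRHS](@big_cat_nat _ _ _ n)//= ?leq_addl// lerDl sumr_ge0// => k _.
  exact/ltW/floyd_function_gt0.
rewrite (@big_cat_nat _ _ _ s.*2)//= ?leq_addr//.
have le1 : \sum_(0 <= k < s.*2) f (maxn s.*2 k) <= e / 3 + e / 3.
  apply: (@le_trans _ _ (\sum_(s <= k < s.*2) f s.*2 *+ 2)).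
    rewrite big_nat (eq_bigr (fun=> f s.*2)); last first.
      by move=> k /andP[_ ks]; congr f; apply/maxn_idPl/ltnW.
    rewrite -big_nat !sumr_const_nat -mulrnA.
    by have -> : (s.*2 - 0 = 2 * (s.*2 - s))%N by lia.
  rewrite sumrMnl mulr2n; have := sP s.*2.
  suff : \sum_(s <= k < s.*2) f s.*2 <= \sum_(s <= k < s.*2) f k by lra.
  by apply: ler_sum_nat => k /andP[_ ks]; exact/floyd_function_le/ltnW.
have le2 : \sum_(s.*2 <= k < s.*2 + n) f (maxn s.*2 k) <= e / 3.
  apply: le_trans (sP (s.*2 + n)%N).
  rewrite [leRHS](@big_cat_nat _ _ _ s.*2)//= ?leq_addr -?addnn ?leq_addr//.
  rewrite (eq_big_nat _ _ (F2 := f)); last first.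
    by move=> k /andP[sk _]; congr f; apply/maxn_idPr.
  by rewrite lerDr sumr_ge0// => k _; exact/ltW/floyd_function_gt0.
lra.
Qed.

(** Iterating [eps * f n <= f n.+1] gives [K = eps^-1 ^+ l]. *)
Lemma floyd_function_ratio l : exists2 K, 0 < K &
  forall m n, (n <= m + l)%N -> f m <= K * f n.
Proof.
case: ff => f0 _ _ [eps /andP[eps0 _] fr]; exists (eps^-1 ^+ l).
  by rewrite exprn_gt0// invr_gt0.
have step m : f m <= eps^-1 ^+ l * f (m + l)%N.
  elim: l => [|k IH]; first by rewrite expr0 mul1r addn0.
  apply: le_trans IH _; rewrite exprSr -mulrA ler_pM2l ?exprn_gt0 ?invr_gt0//.
  by rewrite addnS -ler_pdivrMl ?invr_gt0// invrK; case/andP: (fr (m + k)%N).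
move=> m n nml; apply: le_trans (step m) _.
by rewrite ler_pM2l ?exprn_gt0 ?invr_gt0// floyd_function_le.
Qed.

End FloydFunction.

(** * Geometry of the Floyd distance *)

Section FloydGeometry.
Context {R : realType} {G : groupType} {S : {fset G}} {f : nat -> R}.
Hypotheses (genS : generates S) (ff : floyd_function f).
Local Notation len := (word_length S).
Local Notation d := (floyd_dist S f).

Lemma floyd_dist_le_path x p : path (Defs.adjacent S) x p ->
  d x (last x p) <= path_length S f x p.
Proof.
move=> xp; apply: ge_inf; last by exists p.
exists 0 => _ [q _ <-]; rewrite /path_length; elim: q x {xp} => [|y q IH] x /=.
  by rewrite big_nil.
by rewrite big_cons addr_ge0// ltW// (floyd_function_gt0 ff).
Qed.

Lemma floyd_dist_adjacent x y : Defs.adjacent S x y -> d x y <= f (len x).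
Proof.
move=> xy; have := @floyd_dist_le_path x [:: y]; rewrite /= xy => /(_ isT).
move=> /le_trans; apply; rewrite /path_length /= big_seq1.
by apply: (floyd_function_le ff); exact: leq_maxl.
Qed.

Lemma floyd_dist_geodesic T c (a : nat -> nat) : geodesic S T c ->
  (forall i, (i < T)%N -> (a i <= len (c i))%N) ->
  d (c 0%N) (c T) <= \sum_(i < T) f (a i).
Proof.
elim: T => [|T IH] gc ac; first by rewrite big_ord0 (floyd_distxx genS ff).
rewrite big_ord_recr /= (le_trans (floyd_dist_triangle genS ff (c T) _ _))//.
rewrite lerD ?IH//.
- by move=> i j /andP[ij jT]; rewrite gc// ij leqW.
- by move=> i iT; exact/ac/leqW.
- have adj : Defs.adjacent S (c T) (c T.+1).
    by apply: (word_length1_adjacent genS); rewrite gc ?leqnSn ?leqnn// subSnn.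
  apply: le_trans (floyd_dist_adjacent adj) _.
  by apply: (floyd_function_le ff); exact: ac.
Qed.

(** Translation by [x] changes word lengths by at most [len x], hence edge lengths by a bounded
    factor; [d] itself is not invariant. *)
Lemma floyd_dist_mull x : exists2 K, 0 < K &
  forall u v, d (x * u) (x * v) <= K * d u v.
Proof.
have [K K0 Kf] := floyd_function_ratio ff (len x).
exists K => // u v; rewrite mulrC -ler_pdivrMr//.
apply: lb_le_inf => [|_ [p [/= up pv] <-]].
  have [p up pv] := adjacent_path genS u v.
  by exists (path_length S f u p), p.
rewrite ler_pdivrMr// mulrC.
have -> : (x * v = last (x * u) [seq x * y | y <- p])%g.
  by rewrite last_map pv.
have xp : path (Defs.adjacent S) (x * u)%g [seq (x * y)%g | y <- p].
  elim: p u up {pv} => //= y p IH u /andP[uy yp].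
  rewrite IH// andbT /Defs.adjacent !invgM !mulgA !mulgVK.
  by move: uy.
apply: le_trans (floyd_dist_le_path xp) _.
rewrite /path_length; elim: p u {up pv xp} => [|y p IH] u /=.
  by rewrite !big_nil mulr0.
rewrite !big_cons mulrDr lerD//; apply: Kf.
have lenx z : (len z <= len (x * z) + len x)%N.
  by have := word_lengthM genS x^-1 (x * z); rewrite mulKg (word_lengthV genS) addnC.
by have := lenx u; have := lenx y; rewrite /edge_length; lia.
Qed.

(** Each value of [i./2] is taken at most twice. *)
Let half_cutoff_sum r n :
  \sum_(i < n) f (maxn r i./2) <= \sum_(k < n) f (maxn r k) *+ 2.
Proof.
have fge0 k : 0 <= f k by exact/ltW/(floyd_function_gt0 ff).
have -> : \sum_(k < n) f (maxn r k) *+ 2 = \sum_(i < n.*2) f (maxn r i./2).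
  elim: n => [|n IH]; first by rewrite !big_ord0.
  rewrite big_ord_recr doubleS 2!big_ord_recr /= IH -addrA.
  by rewrite uphalf_double doubleK.
rewrite -!(big_mkord xpredT (fun i => f (maxn r i./2))).
by rewrite [leRHS](@big_cat_nat _ _ _ n)//= -?addnn ?leq_addr// lerDl sumr_ge0.
Qed.

(* Seen from its point nearest to 1, a geodesic moves away from 1 at speed at
   least 1/2, so its Floyd length is at most a multiple of a tail of f. *)
Lemma floyd_dist_far_geodesic e : 0 < e -> exists r, forall T c,
  geodesic S T c -> (forall i, (i <= T)%N -> (r <= len (c i))%N) ->
  d (c 0%N) (c T) <= e.
Proof.
move=> e0; have e40 : 0 < e / 4 by rewrite divr_gt0.
have [r rP] := floyd_function_cutoff ff e40; exists r => T c gc cr.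
have half n (c' : nat -> G) : geodesic S n c' ->
    (forall i, (i <= n)%N -> (r <= len (c' i))%N) ->
    (forall i, (i <= n)%N -> (len (c' 0%N) <= len (c' i))%N) ->
    d (c' 0%N) (c' n) <= e / 2.
  move=> gc' rc' min; apply: (@le_trans _ _ (\sum_(i < n) f (maxn r i./2))).
    apply: (floyd_dist_geodesic (a := fun i => maxn r i./2)) => // i /ltnW iT.
    rewrite geq_max rc'//=.
    (* Minimality at time 0 gives [i <= len (c' 0) + len (c' i) <= 2 * len (c' i)]. *)
    have := word_lengthM genS (c' 0%N)^-1 (c' i); rewrite gc' ?iT// subn0.
    by rewrite (word_lengthV genS); have := min i iT; lia.
  apply: le_trans (half_cutoff_sum r n) _; rewrite sumrMnl mulr2n.
  by have := rP n; lra.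
have [/= m _ mmin] := @arg_minnP 'I_T.+1 ord0 xpredT (fun i => len (c i)) isT.
have mT : (m <= T)%N by rewrite -ltnS.
have {}mmin i : (i <= T)%N -> (len (c m) <= len (c i))%N.
  by move=> iT; exact: (mmin (Ordinal (iT : (i < T.+1)%N)) isT).
have := half m _ (geodesic_rev genS mT gc).
have mTT : (m + (T - m) <= T)%N by rewrite subnKC.
have := half (T - m)%N _ (geodesic_sub mTT gc); rewrite addn0 subnKC// subn0 subnn.
move=> h1 h2; apply: le_trans (floyd_dist_triangle genS ff (c m) _ _) _.
rewrite (floyd_dist_sym _ _ (c 0%N)) (splitr e) lerD//.
- by apply: h2 => i im; rewrite ?cr ?mmin; lia.
- by apply: h1 => i im; rewrite ?cr ?mmin; lia.
Qed.

(** A geodesic of length at most [n] from a point of length at least [maxn m n + n] stays at length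
    at least [maxn m n]. *)
Lemma floyd_dist_near e n : 0 < e -> exists m, forall x y,
  (m <= len x)%N -> (len (x^-1 * y) <= n)%N -> d x y <= e.
Proof.
move=> e0; have [m mP] := floyd_function_cutoff ff e0.
exists (maxn m n + n)%N => x y xm xyn.
have [c [gc c0 cT]] := geodesic_exists genS x y.
rewrite -c0 -[in leLHS]cT; apply: le_trans (mP _).
apply: (floyd_dist_geodesic (a := maxn m)) => // i iT.
have := word_length_lip genS x (c i); rewrite -{2}c0 gc; lia.
Qed.

(** On a geodesic from 1 the vertex at time [t + i] has length [t + i], so the Floyd length after
    time [t] is bounded by a cut-off sum. *)
Lemma floyd_dist_ray e : 0 < e -> exists m, forall T c t,
  geodesic S T c -> c 0%N = 1%g -> (m <= t <= T)%N -> d (c t) (c T) <= e.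
Proof.
move=> e0; have [m mP] := floyd_function_cutoff ff e0.
exists m => T c t gc c0 /andP[mt tT]; apply: le_trans (mP (T - t)%N).
have tTT : (t + (T - t) <= T)%N by rewrite subnKC.
have := floyd_dist_geodesic (a := maxn m) (geodesic_sub tTT gc).
rewrite addn0 subnKC//; apply => i iT.
have := gc 0%N (t + i)%N; rewrite c0 invg1 mul1g; lia.
Qed.

(** Karlsson's visibility lemma, the contrapositive of [floyd_dist_far_geodesic]. *)
Lemma floyd_dist_visibility e : 0 < e -> exists r, forall T c,
  geodesic S T c -> e <= d (c 0%N) (c T) ->
  exists2 t, (t <= T)%N & (len (c t) <= r)%N.
Proof.
move=> e0; have e20 : 0 < e / 2 by rewrite divr_gt0.
have [r rP] := floyd_dist_far_geodesic e20; exists r => T c gc cT.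
apply: contrapT => h; have : d (c 0%N) (c T) <= e / 2.
  apply: rP => // i iT; apply: ltnW; rewrite ltnNge; apply/negP => ir.
  by apply: h; exists i.
lra.
Qed.

(** Floyd-separated points have bounded Gromov product at 1: a geodesic from [x^-1] to [y] has
    length [len (x * y)] and meets the ball of radius [r]. *)
Lemma floyd_dist_word_lengthM e : 0 < e -> exists r, forall x y,
  e <= d x^-1 y -> (len x + len y <= len (x * y) + r)%N.
Proof.
move=> e0; have [r rP] := floyd_dist_visibility e0.
exists r.*2 => x y xy; have [c [+ c0 +]] := geodesic_exists genS x^-1 y.
rewrite invgK; move: (len (x * y)) => T gc cT.
have [|t tT ct] := rP _ _ gc; first by rewrite c0 cT.
have := word_length_lip genS y (c t); have := word_length_lip genS x^-1 (c t).
rewrite (word_lengthV genS) (word_length_sym genS y).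
by have := gc 0%N t; have := gc t T; rewrite c0 cT; lia.
Qed.

(* A convergence property: left translation by a long x is Floyd-contracting
   to x away from x^-1, since a geodesic from x to x * y that comes close to 1
   is the translate of one from 1 to y that passes close to x^-1. *)
Lemma floyd_dist_contraction e : 0 < e -> exists L, forall x y,
  (L <= len x)%N -> e <= d x^-1 y -> d x (x * y) <= e.
Proof.
move=> e0; have e30 : 0 < e / 3 by rewrite divr_gt0.
have [r rP] := floyd_dist_far_geodesic e0.
have [m mP] := floyd_dist_near r e30; have [p pP] := floyd_dist_ray e30.
(* If [x * c i] has length below [r], then [c i] is [e / 3]-close to [x^-1] by the bound [m], and
   [i >= p] makes it [e / 3]-close to [y], against [e <= d x^-1 y]. *)
exists (maxn m (p + r))%N => x y; rewrite geq_max => /andP[mx px] xy.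
have [c [gc c0 cT]] := geodesic_exists genS 1%g y.
move: (len _) gc cT => T gc cT.
have := rP _ _ (geodesic_mul x gc); rewrite c0 cT mulg1; apply => i iT.
rewrite leqNgt; apply/negP => ir.
have xi : (len (x^-1^-1 * c i) <= r)%N by rewrite invgK ltnW.
have := mP x^-1%g (c i); rewrite (word_lengthV genS) => /(_ mx xi).
have lci : len (c i) = i.
  by have := gc 0%N i; rewrite c0 invg1 mul1g subn0; apply.
have pi : (p <= i)%N.
  have := word_length_lip genS x^-1 (c i); rewrite (word_lengthV genS); lia.
have := pP _ _ i gc c0; rewrite pi iT cT => /(_ isT).
have := floyd_dist_triangle genS ff (c i) x^-1 y; lra.
Qed.

End FloydGeometry.

(** * Stable length *)

Section StableLength.
Context {R : realType}.

(* Fekete's lemma; the term at n = 0 is 0 / 0 = 0. *)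
Lemma subadditive_is_cvg (a : nat -> nat) :
  (forall m n, (a (m + n) <= a m + a n)%N) ->
  cvgn (fun n => (a n)%:R / n%:R : R).
Proof.
move=> asub; pose A : set R := [set (a n.+1)%:R / n.+1%:R | n in [set: nat]].
have infA : has_inf A.
  split; first by exists ((a 1%N)%:R / 1%:R), 0%N.
  by exists 0 => _ [n _ <-]; rewrite divr_ge0.
suff: (fun n => (a n)%:R / n%:R : R) @ \oo --> inf A by move=> h; apply: cvgP h.
apply/cvgrPdist_le => e e0; have e20 : 0 < e / 2 by rewrite divr_gt0.
have [_ [p _ <-] pe] := inf_adherent e20 infA.
(* Beyond [N], the remainder of the division of [n] by [p.+1] costs at most [e / 2 * n]. *)
have [N _ HN] := nbhs_infty_gtr ((p.+1 * a 1%N + a 0%N)%:R / (e / 2)).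
have I0 : 0 <= inf A.
  by apply: lb_le_inf; [case: infA|move=> _ [n _ <-]; rewrite divr_ge0].
exists N.+1 => // n /= Nn; have n0 : (0 < n)%N by lia.
have ge_infA : inf A <= (a n)%:R / n%:R.
  by apply: ge_inf; [case: infA|exists n.-1 => //; rewrite prednK].
have le_infA : (a n)%:R / n%:R <= inf A + e.
  rewrite ler_pdivrMr ?ltr0n//.
  have aM k m : (a (k * p.+1 + m) <= k * a p.+1 + m * a 1%N + a 0%N)%N.
    elim: k => [|k IH].
      elim: m => [|m IH]; first by rewrite !mul0n.
      by have := asub 1%N m; rewrite !mul0n !add0n add1n in IH *; lia.
    by have := asub p.+1 (k * p.+1 + m)%N; rewrite addnA -mulSn; lia.
  have an : (a n <= (n %/ p.+1) * a p.+1 + (p.+1 * a 1%N + a 0%N))%N.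
    rewrite {1}(divn_eq n p.+1) (leq_trans (aM _ _))// -addnA leq_add2l.
    by rewrite leq_add2r leq_mul2r ltnW ?orbT// ltn_pmod.
  have cn : (p.+1 * a 1%N + a 0%N)%:R <= e / 2 * n%:R.
    by rewrite mulrC -ler_pdivrMr// ltW// HN//=; lia.
  have kn : (n %/ p.+1)%:R * p.+1%:R <= n%:R :> R.
    by rewrite -natrM ler_nat leq_trunc_div.
  have ap : (a p.+1)%:R <= (inf A + e / 2) * p.+1%:R.
    by rewrite -ler_pdivrMr// ltW.
  have k0 : 0 <= (n %/ p.+1)%:R :> R by [].
  move: an; rewrite -(ler_nat R) natrD natrM => /le_trans; apply.
  have := ler_wpM2l k0 ap; have : 0 <= inf A + e / 2 by lra.
  by move=> /ler_wpM2l/(_ _ _ kn); lra.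
rewrite ler_norml; lra.
Qed.

Context {G : groupType} {S : {fset G}} (genS : generates S).
Local Notation len := (word_length S).

Lemma stable_length_ge (g : G) (c : R) :
  (forall n, c * n.+1%:R <= (len (g ^+ n.+1))%:R) -> c <= stable_length R S g.
Proof.
move=> cg; apply: limr_ge.
  by apply: (subadditive_is_cvg (a := fun n => len (g ^+ n)%g)) => m n;
    rewrite expgnDr (word_lengthM genS).
by exists 1%N => // -[//|n] _ /=; rewrite ler_pdivlMr.
Qed.

End StableLength.

(** * Elements with north-south dynamics *)

Section Powers.
Context {R : realType} {G : groupType} {S : {fset G}} {f : nat -> R}.
Hypotheses (genS : generates S) (ff : floyd_function f).
Local Notation len := (word_length S).
Local Notation d := (floyd_dist S f).

Let dtri := floyd_dist_triangle genS ff.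
Let dsym := floyd_dist_sym S f.

Lemma floyd_dist_powers e : 0 < e -> exists L, forall x,
  (L <= len x)%N -> e <= d x x^-1 -> forall n, d x (x ^+ n.+1) <= e / 4.
Proof.
move=> e0; have e40 : 0 < e / 4 by rewrite divr_gt0.
have [L LP] := floyd_dist_contraction genS ff e40.
exists L => x Lx xx; elim=> [|n IH].
  by rewrite expg1 (floyd_distxx genS ff) ltW.
rewrite expgS; apply: LP => //.
have := dtri (x ^+ n.+1) x x^-1; rewrite (dsym (x ^+ n.+1)); lra.
Qed.

(** For long [x] each further factor [x] loses at most [r], so the stable length is at least
    [len x - r]; the summand [L] of the constant takes care of short [x]. *)
Lemma word_length_sub_stable_length e : 0 < e -> exists C : nat, forall x,
  e <= d x x^-1 -> (len x)%:R - stable_length R S x <= C%:R.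
Proof.
move=> e0; have [L LP] := floyd_dist_powers e0.
have e20 : 0 < e / 2 by rewrite divr_gt0.
have [r rP] := floyd_dist_word_lengthM genS ff e20.
exists (L + r)%N => x xx; have [xL|Lx] := ltnP (len x) L.
  have : 0 <= stable_length R S x.
    by apply: stable_length_ge => // n; rewrite mul0r.
  have : (len x)%:R <= (L + r)%:R :> R by rewrite ler_nat; lia.
  lra.
have grow n : (len x + len (x ^+ n.+1) <= len (x ^+ n.+2) + r)%N.
  rewrite [in leqRHS]expgS; apply: rP; have := LP x Lx xx n.
  have := dtri (x ^+ n.+1) x x^-1; rewrite (dsym (x ^+ n.+1)); lra.
have lin n : (n.+1 * len x <= len (x ^+ n.+1) + n * r)%N.
  elim: n => [|n IH]; first by rewrite expg1; lia.
  have := grow n; lia.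
suff : (len x)%:R - (r)%:R <= stable_length R S x 
  by rewrite natrD; have : 0 <= L%:R :> R by []; lra.
apply: stable_length_ge => // n; have := lin n.
rewrite -(ler_nat R) natrD !natrM -natr1.
have : 0 <= (r)%:R :> R by []; lra.
Qed.

(** Uniformity in both exponents lets the same [e] serve for inverses and for positive powers. *)
Definition loxodromic (e : R) (g : G) : Prop :=
  forall i j, e <= d (g ^+ i.+1) (g^-1 ^+ j.+1).

Lemma loxodromicV e g : loxodromic e g -> loxodromic e g^-1.
Proof. by move=> lg i j; rewrite invgK dsym. Qed.

Lemma loxodromicX e g m : loxodromic e g -> loxodromic e (g ^+ m.+1).
Proof. by move=> lg i j; rewrite -expVgn -!expgnA; apply: lg. Qed.

Lemma loxodromic_exists e : 0 < e -> exists L, forall x,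
  (L <= len x)%N -> e <= d x x^-1 -> loxodromic (e / 2) x.
Proof.
move=> e0; have [L LP] := floyd_dist_powers e0.
exists L => x Lx xx i j; have h1 := LP x Lx xx i.
have := LP x^-1%g; rewrite (word_lengthV genS) invgK dsym => /(_ Lx xx j) h2.
have := dtri (x ^+ i.+1) x x^-1; rewrite (dsym x^-1) in h2.
have := dtri (x^-1 ^+ j.+1) (x ^+ i.+1) x^-1; lra.
Qed.

Section Loxodromic.
Variables (e : R) (g : G).
Hypotheses (e0 : 0 < e) (lg : loxodromic e g).

Lemma loxodromic_expg_neq1 n : (g ^+ n.+1 <> 1)%g.
Proof.
move=> gn; have := lg n n.
by rewrite expVgn gn invg1 (floyd_distxx genS ff) leNgt e0.
Qed.

Lemma loxodromic_expg_inj : injective (fun n => (g ^+ n)%g).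
Proof.
have lt m n : (m < n)%N -> (g ^+ m <> g ^+ n)%g.
  move=> mn gmn; apply: (@loxodromic_expg_neq1 (n - m).-1).
  by rewrite prednK ?subn_gt0// expgnFr 1?ltnW// gmn mulgV.
by move=> m n /= gmn; case: (ltngtP m n) => // /lt; rewrite gmn.
Qed.

Lemma loxodromic_word_length N :
  exists n0, forall n, (n0 <= n)%N -> (N <= len (g ^+ n))%N.
Proof.
have : finite_set ((fun n => (g ^+ n)%g) @^-1` [set x | (len x <= N)%N]).
  apply: finite_preimage; last exact: finite_word_ball.
  by move=> m n _ _; apply: loxodromic_expg_inj.
move=> /finite_seqP[s sE]; exists (\max_(i <- s) i).+1 => n sn.
rewrite leqNgt; apply/negP => /ltnW nN.
have : n \in s by have : [set` s] n by rewrite -sE.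
move=> ns; move: sn; rewrite ltnNge => /negP; apply.
by rewrite (big_rem n ns) leq_maxl.
Qed.

(** Write [g ^+ n] as [g ^+ m * g ^+ (n - m)]: the second factor is [e]-far from the inverse of the
    first, so the contraction property applies. *)
Lemma loxodromic_cauchy a : 0 < a ->
  exists n0, forall m n, (n0 <= m)%N -> (n0 <= n)%N -> d (g ^+ m) (g ^+ n) <= a.
Proof.
move=> a0; have a'0 : 0 < Num.min a e by rewrite lt_min a0.
have [L LP] := floyd_dist_contraction genS ff a'0.
have [N NP] := loxodromic_word_length L.
have lt m n : (N < m)%N -> (m < n)%N -> d (g ^+ m) (g ^+ n) <= a.
  move=> Nm mn; apply: (@le_trans _ _ (Num.min a e)); last by rewrite ge_min lexx.
  rewrite -(subnKC (ltnW mn)) expgnDr; apply: LP; first exact/NP/ltnW.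
  rewrite ge_min; apply/orP; right.
  have := lg (n - m).-1 m.-1; rewrite !prednK ?subn_gt0//; last by lia.
  by rewrite expVgn dsym.
exists N.+1 => m n Nm Nn; case: (ltngtP m n) => [|nm|->].
- exact: lt.
- by rewrite dsym; exact: lt.
- by rewrite (floyd_distxx genS ff) ltW.
Qed.

End Loxodromic.
End Powers.

Arguments loxodromic {R G} S f e g.

(** * Ends of loxodromic elements *)

Lemma finite_range_collision (T : Type) (A : set T) (u : nat -> T) :
  finite_set A -> (forall n, A (u n)) -> exists m n, (m < n)%N /\ u m = u n.
Proof.
move=> finA Au; apply: contrapT => h; apply: infinite_nat.
have -> : [set: nat] = u @^-1` A by apply/seteqP; split=> n _ //; exact: Au.
apply: finite_preimage finA => m n _ _ umn; apply: contrapT => /eqP.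
by rewrite neq_ltn => /orP[mn|nm]; apply: h; [exists m, n|exists n, m].
Qed.

Section Ends.
Context {R : realType} {G : groupType} {S : {fset G}} {f : nat -> R}.
Hypotheses (genS : generates S) (ff : floyd_function f).
Local Notation len := (word_length S).
Local Notation d := (floyd_dist S f).

Let dtri := floyd_dist_triangle genS ff.
Let dsym := floyd_dist_sym S f.

(** For loxodromic elements this is equality of the limits of their positive powers in the
    completion, stated inside the group. *)
Definition same_end (g h : G) : Prop := forall e : R, 0 < e ->
  exists n0, forall m n, (n0 <= m)%N -> (n0 <= n)%N -> d (g ^+ m) (h ^+ n) <= e.

Definition distinct_ends (g h : G) : Prop := exists2 e : R, 0 < e &
  exists n0, forall m n, (n0 <= m)%N -> (n0 <= n)%N -> e <= d (g ^+ m) (h ^+ n).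

Lemma same_end_distinct g h : same_end g h -> distinct_ends g h -> False.
Proof.
move=> gh [e e0 [n0 n0P]]; have e20 : 0 < e / 2 by rewrite divr_gt0.
have [n1 n1P] := gh _ e20.
have := n0P (n0 + n1)%N (n0 + n1)%N (leq_addr _ _) (leq_addr _ _).
have := n1P (n0 + n1)%N (n0 + n1)%N (leq_addl _ _) (leq_addl _ _); lra.
Qed.

Section TwoLoxodromics.
Variables (eg eh : R) (g h : G).
Hypotheses (eg0 : 0 < eg) (eh0 : 0 < eh).
Hypotheses (lg : loxodromic S f eg g) (lh : loxodromic S f eh h).

(** Both sequences of powers are Cauchy, so a single close pair far out makes all later pairs
    close. *)
Lemma not_distinct_same_end : ~ distinct_ends g h -> same_end g h.
Proof.
move=> gh e e0; have e30 : 0 < e / 3 by rewrite divr_gt0.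
have [m0 m0P] := loxodromic_cauchy genS ff eg0 lg e30.
have [n0 n0P] := loxodromic_cauchy genS ff eh0 lh e30.
have [m [n [mm nn mn]]] : exists m n,
    [/\ (m0 + n0 <= m)%N, (m0 + n0 <= n)%N & d (g ^+ m) (h ^+ n) < e / 3].
  apply: contrapT => H; apply: gh; exists (e / 3) => //.
  exists (m0 + n0)%N => m n mm nn; rewrite leNgt; apply/negP => mn.
  by apply: H; exists m, n.
exists (m0 + n0)%N => m' n' mm' nn'.
have := dtri (g ^+ m) (g ^+ m') (h ^+ n').
have := dtri (h ^+ n) (g ^+ m) (h ^+ n').
have : d (g ^+ m') (g ^+ m) <= e / 3 by apply: m0P; lia.
have : d (h ^+ n) (h ^+ n') <= e / 3 by apply: n0P; lia.
lra.
Qed.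

(* Seen from h ^+ n, the point 1 and the far powers of g are Floyd-apart. So a
   geodesic from 1 to a far power of g passes near h ^+ n; it also passes near
   the intermediate powers of g. *)
Lemma same_end_near : same_end g h ->
  exists D, forall n, exists k, (len ((g ^+ k)^-1 * h ^+ n) <= D)%N.
Proof.
move=> gh; pose e := Num.min eg (eh / 2).
have e0 : 0 < e by rewrite lt_min eg0 divr_gt0.
have [r rP] := floyd_dist_visibility genS ff e0.
exists (r * 4 + len g)%N => -[|n].
  by exists 0%N; rewrite !expg0 invg1 mul1g word_length1.
(* [K] is the Lipschitz constant of translation by the inverse of [h ^+ n.+1]; it fixes how close
   the powers of [g] and [h] must be before translating. *)
have [K K0 KP] := floyd_dist_mull genS ff (h ^+ n.+1)^-1.
have a0 : 0 < eh / 2 / K by rewrite !divr_gt0.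
have [n0 n0P] := gh _ a0.
pose M := (n.+1 + n0.+1)%N.
have [c [+ c0 +]] := geodesic_exists genS 1%g (g ^+ M)%g.
move: (len (_ * _)) => T gc cT.
have [t tT ct] : exists2 t, (t <= T)%N & (len ((h ^+ n.+1)^-1 * c t) <= r)%N.
  apply: (rP _ _ (geodesic_mul (h ^+ n.+1)^-1%g gc)); rewrite c0 cT mulg1.
  apply: (@le_trans _ _ (eh / 2)); first by rewrite ge_min lexx orbT.
  have gM : d ((h ^+ n.+1)^-1 * g ^+ M) (h ^+ n0.+1) <= eh / 2.
    rewrite -[(h ^+ n0.+1)%g](mulKg (h ^+ n.+1)%g) -expgnDr.
    apply: le_trans (KP _ _) _; rewrite mulrC -ler_pdivlMr//.
    by apply: n0P; rewrite /M; lia.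
  have := lh n0 n; rewrite expVgn.
  have := dtri ((h ^+ n.+1)^-1 * g ^+ M) (h ^+ n.+1)^-1 (h ^+ n0.+1).
  rewrite (dsym (h ^+ n0.+1)); lra.
have near k : (k <= M)%N ->
    exists2 u, (u <= T)%N & (len ((g ^+ k)^-1 * c u) <= r)%N.
  move=> kM; have [->|k0] := posnP k.
    by exists 0%N => //; rewrite expg0 c0 mulVg word_length1.
  have [->|kM'] := eqVneq k M.
    by exists T => //; rewrite cT mulVg word_length1.
  apply: (rP _ _ (geodesic_mul (g ^+ k)^-1%g gc)); rewrite c0 cT mulg1.
  apply: (@le_trans _ _ eg); first by rewrite ge_min lexx.
  have {}kM : (k < M)%N by rewrite ltn_neqAle kM'.
  have := lg (M - k).-1 k.-1; rewrite !prednK ?subn_gt0// expVgn dsym.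
  by rewrite -{2}(subnKC (ltnW kM)) expgnDr mulKg.
(* Discrete continuity in [k]: when the point near [g ^+ k] jumps from before [t] to after [t], the
   jump has length at most [2 * r + len g], so [c t] is near [g ^+ k]. *)
have cross k : (k <= M)%N ->
    (exists j, (len ((g ^+ j)^-1 * c t) <= r * 3 + len g)%N) \/
    (exists2 u, (u <= t)%N & (len ((g ^+ k)^-1 * c u) <= r)%N).
  elim: k => [|k IH] kM.
    by right; exists 0%N => //; rewrite expg0 c0 mulVg word_length1.
  have [|[u ut uk]] := IH (ltnW kM); first by left.
  have [v vT vk] := near _ kM.
  have [vt|tv] := leqP v t; first by right; exists v.
  left; exists k; have := word_length_triangle genS (c u) (g ^+ k) (c t).
  rewrite gc ?ut//.
  have := word_length_triangle genS (g ^+ k) (c u) (c v).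
  have := word_length_triangle genS (g ^+ k.+1) (g ^+ k) (c v).
  rewrite [in ((g ^+ k)^-1 * g ^+ k.+1)%g]expgSr mulKg gc ?vT; last by lia.
  by rewrite (word_length_sym genS (c u)); lia.
have [[j jt]|[u ut uM]] := cross M (leqnn _).
  exists j; have := word_length_triangle genS (c t) (g ^+ j) (h ^+ n.+1).
  by rewrite (word_length_sym genS (c t)); lia.
exists M; have := word_length_triangle genS (c t) (g ^+ M) (h ^+ n.+1).
have := gc u T; have := gc t T; rewrite cT.
rewrite (word_length_sym genS (c t) (g ^+ M)) (word_length_sym genS (c u)).
by rewrite (word_length_sym genS (c t)); lia.
Qed.

End TwoLoxodromics.

(* By pigeonhole some positive power of h is a power of g. *)
Lemma same_endV eg eh g h : 0 < eg -> 0 < eh ->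
  loxodromic S f eg g -> loxodromic S f eh h ->
  same_end g h -> same_end g^-1 h^-1.
Proof.
move=> eg0 eh0 lg lh gh; have [D /choice[k kD]] := same_end_near eg0 eh0 lg lh gh.
have [m [n [mn]]] := finite_range_collision (finite_word_ball genS D) kD.
move=> hmn; have {hmn}hE : (h ^+ (n - m) = g ^+ k n / g ^+ k m)%g.
  rewrite expgnFr ?(ltnW mn)// -[(h ^+ n)%g](mulVKg (g ^+ k n)%g) -hmn.
  by rewrite -!mulgA mulgV mulg1.
(* So [h ^+ (n - m)] is a power of [g]. A positive exponent gives the inverses common powers
   arbitrarily far out; a negative one contradicts [same_end g h] because [g] is loxodromic;
   exponent 0 would make [h] torsion. *)
have [kmn|kmn|kmn] := ltngtP (k m) (k n).
- apply: (not_distinct_same_end eg0 eh0 (loxodromicV lg) (loxodromicV lh)).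
  move=> [e e0 [n0 n0P]].
  have := n0P ((k n - k m) * n0)%N ((n - m) * n0)%N; rewrite !leq_pmull ?subn_gt0//.
  rewrite !expVgn !expgnA hE -expgnFr 1?ltnW// (floyd_distxx genS ff).
  by move=> /(_ isT isT); rewrite leNgt e0.
- have eg20 : 0 < eg / 2 by rewrite divr_gt0.
  have [n0 n0P] := gh _ eg20.
  have := n0P ((k m - k n) * n0.+1)%N ((n - m) * n0.+1)%N.
  rewrite !(leq_trans (leqnSn n0)) ?leq_pmull ?subn_gt0// => /(_ isT isT).
  rewrite [X in d _ X]expgnA hE -(invgF (g ^+ k m)%g) -expgnFr 1?ltnW//.
  have t0 : (0 < (k m - k n) * n0.+1)%N by rewrite muln_gt0 subn_gt0 kmn.
  rewrite -expVgn -expgnA -(prednK t0) => gg.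
  have := le_trans (lg _ _) gg; lra.
- move: hE; rewrite kmn mulgV -(@prednK (n - m)) ?subn_gt0// => hs.
  by case: (loxodromic_expg_neq1 genS ff eh0 lh hs).
Qed.

End Ends.

Arguments same_end {R G} S f g h.
Arguments distinct_ends {R G} S f g h.

(** * Subgroups with three directions *)

Section Spread.
Context {R : realType} {G : groupType} {S : {fset G}} {f : nat -> R}.
Hypotheses (genS : generates S) (ff : floyd_function f).
Local Notation len := (word_length S).
Local Notation d := (floyd_dist S f).

Let dtri := floyd_dist_triangle genS ff.
Let dsym := floyd_dist_sym S f.

Definition spread (e : R) (x y z : G) : Prop :=
  [/\ e <= d x y, e <= d x z & e <= d y z].

Definition long_triple (H : {pred G}) (n : nat) (x y z : G) : Prop :=
  [/\ x \in H, y \in H & z \in H] /\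
  [/\ (n <= len x)%N, (n <= len y)%N & (n <= len z)%N].

(** A trace inside the group of three distinct limit points; [e] does not depend on [n]. *)
Definition has_spread (H : {pred G}) : Prop := exists2 e : R, 0 < e &
  forall n, exists x y z, long_triple H n x y z /\ spread e x y z.

Lemma spread_far e x y z p : spread e x y z ->
  [\/ e / 2 <= d x p /\ e / 2 <= d y p,
      e / 2 <= d x p /\ e / 2 <= d z p |
      e / 2 <= d y p /\ e / 2 <= d z p].
Proof.
move=> [xy xz yz].
have far u v : e <= d u v -> e / 2 <= d u p \/ e / 2 <= d v p.
  move=> uv; case: (leP (e / 2) (d u p)); [by left|move=> up; right].
  by have := dtri p u v; rewrite (dsym p v); lra.
case: (far _ _ xy) => [xp|yp].
- case: (far _ _ yz) => [yp|zp]; first by constructor 1.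
  by constructor 2.
- case: (far _ _ xz) => [xp|zp]; first by constructor 1.
  by constructor 3.
Qed.

(** Each of [p] and [q] is close to at most one of the three points, so one point remains. *)
Lemma spread_far2 e x y z p q : spread e x y z ->
  exists2 u, u \in [:: x; y; z] & e / 2 <= d u p /\ e / 2 <= d u q.
Proof.
move=> s; have := spread_far p s; have := spread_far q s.
by case=> -[? ?] [] [? ?]; (exists x; [by rewrite !inE eqxx ?orbT|by []]) ||
  (exists y; [by rewrite !inE eqxx ?orbT|by []]) ||
  (exists z; [by rewrite !inE eqxx ?orbT|by []]).
Qed.

(** Take [a], [b] long and apart. If neither is far from its own inverse, then [a * b] is close to
    [a] and its inverse is close to [b^-1], hence to [b], so [a * b] is loxodromic. *)
Lemma loxodromic_in_spread (H : groupClosed G) : has_spread H ->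
  exists e g, [/\ 0 < e, g \in H & loxodromic S f e g].
Proof.
move=> [e e0 sH].
have e80 : 0 < e / 8 by rewrite divr_gt0.
have e40 : 0 < e / 4 by rewrite divr_gt0.
have e20 : 0 < e / 2 by rewrite divr_gt0.
have [L1 L1P] := floyd_dist_contraction genS ff e80.
have [L2 L2P] := loxodromic_exists genS ff e40.
have [r rP] := floyd_dist_word_lengthM genS ff e20.
have [a [b [_ [[[aH bH _] [La Lb _]] [ab _ _]]]]] := sH (L1 + (L2 + r))%N.
have [L1a L1b] : (L1 <= len a)%N /\ (L1 <= len b)%N.
  by split; [apply: leq_trans La|apply: leq_trans Lb]; exact: leq_addr.
have [L2a L2b] : (L2 + r <= len a)%N /\ (L2 + r <= len b)%N.
  by split; [apply: leq_trans La|apply: leq_trans Lb]; exact: leq_addl.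
have [L2a' L2b'] : (L2 <= len a)%N /\ (L2 <= len b)%N.
  by split; [apply: leq_trans L2a|apply: leq_trans L2b]; exact: leq_addr.
have [aa|aa] := leP (e / 4) (d a a^-1).
  by exists (e / 4 / 2), a; split; [rewrite divr_gt0| |exact: L2P].
have [bb|bb] := leP (e / 4) (d b b^-1).
  by exists (e / 4 / 2), b; split; [rewrite divr_gt0| |exact: L2P].
have aVb : e * (3 / 4) <= d a^-1 b by have := dtri a^-1 a b; lra.
have h1 : d a (a * b) <= e / 8 by apply: L1P => //; lra.
have h2 : d b^-1 (a * b)^-1 <= e / 8.
  rewrite invgM; apply: L1P; first by rewrite (word_lengthV genS).
  by rewrite invgK dsym; lra.
exists (e / 4 / 2), (a * b)%g; split; [by rewrite divr_gt0|by rewrite gpredM|].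
apply: L2P; last first.
  have := dtri (a * b) a b; have := dtri b^-1 (a * b) b.
  have := dtri (a * b)^-1 (a * b) b^-1.
  rewrite (dsym (a * b)^-1) (dsym b^-1 b); lra.
rewrite -(leq_add2r r) (leq_trans (leq_trans L2a (leq_addr (len b) _)))//.
by apply: rP; lra.
Qed.

(* The ends of b * g * b^-1 are the translates by b of those of g. *)
Lemma loxodromic_conjugate e0 a g b k L : 0 < e0 -> 0 < a ->
  loxodromic S f e0 g ->
  (forall m n, (k <= m)%N -> (k <= n)%N ->
     d (g ^+ m) (g ^+ n) <= a /\ d (g^-1 ^+ m) (g^-1 ^+ n) <= a) ->
  (forall x y, (L <= len x)%N -> a <= d x^-1 y -> d x (x * y) <= a) ->
  (L <= len b)%N ->
  4 * a <= d b (g ^+ k) -> 4 * a <= d b (g^-1 ^+ k) ->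
  2 * a <= d b^-1 (g ^+ k) ->
  exists (e : R) m, let g1 := (g ^+ m.+1)%g in let h := (g1 ^ b^-1)%g in
    [/\ 0 < e, loxodromic S f e g1, loxodromic S f e h,
        distinct_ends S f h g1 & distinct_ends S f h g1^-1].
Proof.
move=> e00 a0 lg cauchy LP Lb bp bq bVp;
have [K K0 KP] := floyd_dist_mull genS ff b^-1.
(* The bound [a] keeps the powers of [h] close to [b]; the bound [e0 / K / 4] leaves [h] loxodromic
   after two approximations, translation by [b] shrinking distances at most [K] times. *)
pose a' := Num.min a (e0 / K / 4).
have a'0 : 0 < a' by rewrite lt_min a0 !divr_gt0.
have [n1 n1P] := floyd_dist_near genS ff (len b) a'0.
have [n2 n2P] := loxodromic_word_length genS ff e00 lg (n1 + len b)%N.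
have conjE x : (x ^ b^-1 = b * x * b^-1)%g by rewrite conjgE invgK mulgA.
have near x : (n1 + len b <= len x)%N -> d (b * x) (x ^ b^-1) <= a'.
  move=> nx; rewrite conjE; apply: n1P; last by rewrite mulKg (word_lengthV genS).
  by have := word_lengthM genS b^-1 (b * x); rewrite mulKg (word_lengthV genS); lia.
(* The exponent [m.+1] puts all positive powers of [g1] past both [k] and [n2]. *)
pose m := (k + n2)%N; pose g1 := (g ^+ m.+1)%g; pose h := (g1 ^ b^-1)%g.
have big i : (m.+1 <= m.+1 * i.+1)%N by rewrite leq_pmulr.
have nearp i : d (b * g ^+ (m.+1 * i.+1)) (h ^+ i.+1) <= a'.
  rewrite /h -conjXg -expgnA; apply: near; apply: n2P.
  by have := big i; rewrite /m; lia.
have nearn i : d (b * g^-1 ^+ (m.+1 * i.+1)) (h^-1 ^+ i.+1) <= a'.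
  rewrite /h -conjVg -conjXg /g1 -expVgn -expgnA; apply: near.
  rewrite expVgn (word_lengthV genS); apply: n2P.
  by have := big i; rewrite /m; lia.
have lg1 : loxodromic S f e0 g1 by exact: loxodromicX.
have lh : loxodromic S f (e0 / K / 2) h.
  move=> i j; have := nearp i; have := nearn j.
  have : a' <= e0 / K / 4 by rewrite /a' ge_min lexx orbT.
  have : e0 / K <= d (b * g ^+ (m.+1 * i.+1)) (b * g^-1 ^+ (m.+1 * j.+1)).
    rewrite ler_pdivrMr// mulrC; apply: le_trans (KP _ _); rewrite !mulKg.
    by have := loxodromicX m lg i j; rewrite -expVgn -!expgnA.
  have := dtri (h ^+ i.+1) (b * g ^+ (m.+1 * i.+1)) (b * g^-1 ^+ (m.+1 * j.+1)).
  have := dtri (h^-1 ^+ j.+1) (h ^+ i.+1) (b * g^-1 ^+ (m.+1 * j.+1)).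
  rewrite (dsym (h^-1 ^+ j.+1)); lra.
have a'a : a' <= a by rewrite /a' ge_min lexx.
have bg n : (k <= n)%N -> d b (b * g ^+ n) <= a.
  move=> kn; apply: LP => //; have [+ _] := cauchy n k kn (leqnn _).
  have := dtri (g ^+ n) b^-1 (g ^+ k); lra.
(* The powers of [h] stay within [2 * a] of [b], and those of [g1] and its inverse within [a] of
   points [4 * a] away from [b]: this leaves a gap of [a]. *)
have end_b n : (0 < n)%N -> d (h ^+ n) b <= a + a.
  case: n => // n _; have := nearp n.
  have : d b (b * g ^+ (m.+1 * n.+1)) <= a.
    by apply: bg; have := big n; rewrite /m; lia.
  have := dtri (b * g ^+ (m.+1 * n.+1)) b (h ^+ n.+1); rewrite (dsym b (h ^+ _)).
  lra.
have kM n : (0 < n)%N -> (k <= m.+1 * n)%N.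
  by case: n => // n _; have := big n; rewrite /m; lia.
exists (Num.min e0 (e0 / K / 2)), m => /=; split.
- by rewrite lt_min e00 !divr_gt0.
- by move=> i j; apply: le_trans (lg1 i j); rewrite ge_min lexx.
- by move=> i j; apply: le_trans (lh i j); rewrite ge_min lexx orbT.
- exists a => //; exists 1%N => i j i0 j0; rewrite -expgnA.
  have [+ _] := cauchy _ _ (kM j j0) (leqnn _); have := end_b i i0.
  have := dtri (h ^+ i) b (g ^+ k).
  have := dtri (g ^+ (m.+1 * j)) (h ^+ i) (g ^+ k).
  by have := dtri (h ^+ i) b (g ^+ k); rewrite (dsym b (h ^+ i)); lra.
- exists a => //; exists 1%N => i j i0 j0; rewrite -expVgn -expgnA.
  have [_] := cauchy _ _ (kM j j0) (leqnn _); have := end_b i i0.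
  have := dtri (h ^+ i) b (g^-1 ^+ k).
  have := dtri (g^-1 ^+ (m.+1 * j)) (h ^+ i) (g^-1 ^+ k).
  by have := dtri (h ^+ i) b (g ^+ k); rewrite (dsym b (h ^+ i)); lra.
Qed.

End Spread.

Arguments spread {R G} S f e x y z.
Arguments long_triple {G} S H n x y z.
Arguments has_spread {R G} S f H.

(** * Triples apart together with their inverses, and the resulting finite set *)

Section SpreadInverses.
Context {R : realType} {G : groupType} {S : {fset G}} {f : nat -> R}.
Hypotheses (genS : generates S) (ff : floyd_function f).
Local Notation len := (word_length S).
Local Notation d := (floyd_dist S f).

Let dtri := floyd_dist_triangle genS ff.
Let dsym := floyd_dist_sym S f.

(** The triple is [g ^+ N], [g^-1 ^+ N], [h ^+ N]. By [same_endV], an end of [h^-1] shared with [g]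
    or [g^-1] would force [h] to share an end with the inverse of that element. *)
Lemma spread_of_loxodromics (H : groupClosed G) e g h :
  0 < e -> g \in H -> h \in H -> loxodromic S f e g -> loxodromic S f e h ->
  distinct_ends S f h g -> distinct_ends S f h g^-1 ->
  exists2 e' : R, 0 < e' & forall n, exists x y z,
    [/\ long_triple S H n x y z, spread S f e' x y z &
        spread S f e' x^-1 y^-1 z^-1].
Proof.
move=> e0 gH hH lg lh hg hgV.
have lgV := loxodromicV lg; have lhV := loxodromicV lh.
have hVg : distinct_ends S f h^-1 g.
  apply: contrapT => /(not_distinct_same_end genS ff e0 e0 lhV lg).
  move=> /(same_endV genS ff e0 e0 lhV lg); rewrite invgK => /same_end_distinct.
  exact.
have hVgV : distinct_ends S f h^-1 g^-1.
  apply: contrapT => /(not_distinct_same_end genS ff e0 e0 lhV lgV).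
  move=> /(same_endV genS ff e0 e0 lhV lgV); rewrite !invgK => /same_end_distinct.
  exact.
case: hg => e1 e10 [n1 P1]; case: hgV => e2 e20 [n2 P2].
case: hVg => e3 e30 [n3 P3]; case: hVgV => e4 e40 [n4 P4].
exists (Num.min e (Num.min (Num.min e1 e2) (Num.min e3 e4))).
  by rewrite !lt_min e0 e10 e20 e30 e40.
move=> n; have [mg mgP] := loxodromic_word_length genS ff e0 lg n.
have [mh mhP] := loxodromic_word_length genS ff e0 lh n.
pose N := (n1 + n2 + n3 + n4 + mg + mh).+1.
exists (g ^+ N)%g, (g^-1 ^+ N)%g, (h ^+ N)%g; split.
- split; first by split; apply: gpredXn; rewrite ?gpredV.
  by rewrite expVgn (word_lengthV genS) mgP ?mhP//; rewrite /N; lia.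
- rewrite /spread !ge_min; split.
  + by rewrite lg.
  + by rewrite dsym P1 ?orbT//; rewrite /N; lia.
  + by rewrite dsym P2 ?orbT//; rewrite /N; lia.
- rewrite /spread !ge_min -!expVgn invgK; split.
  + by rewrite dsym lg.
  + by rewrite dsym P4 ?orbT//; rewrite /N; lia.
  + by rewrite dsym P3 ?orbT//; rewrite /N; lia.
Qed.

(** An element [b] far from both ends of a loxodromic [g] is used to conjugate. Since [b^-1] can be
    close to only one end of [g], it is far from the other, and [g] is replaced by [g^-1] if
    necessary. *)
Lemma spread_inverses (H : groupClosed G) : has_spread S f H ->
  exists2 e : R, 0 < e & forall n, exists x y z,
    [/\ long_triple S H n x y z, spread S f e x y z &
        spread S f e x^-1 y^-1 z^-1].
Proof.
move=> sH; have [e0 [g [e00 gH lg]]] := loxodromic_in_spread genS ff sH.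
case: sH => e1 e10 sH; have lgV := loxodromicV lg.
(* Then [4 * a <= e1 / 2], the distance supplied by [spread_far2], and [b^-1] cannot be
   [2 * a]-close to both ends of [g], which are [e0] apart. *)
pose a := Num.min e0 e1 / 8.
have a0 : 0 < a by rewrite divr_gt0// lt_min e00.
have [ae0 ae1] : a <= e0 / 8 /\ a <= e1 / 8.
  by rewrite /a !ler_pM2r ?invr_gt0// !ge_min !lexx orbT.
have [n0 P0] := loxodromic_cauchy genS ff e00 lg a0.
have [n1 P1] := loxodromic_cauchy genS ff e00 lgV a0.
pose k := (n0 + n1).+1.
have cauchy m n : (k <= m)%N -> (k <= n)%N ->
    d (g ^+ m) (g ^+ n) <= a /\ d (g^-1 ^+ m) (g^-1 ^+ n) <= a.
  by rewrite /k => km kn; split; [apply: P0|apply: P1]; lia.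
have [L LP] := floyd_dist_contraction genS ff a0.
have [x [y [z [[[xH yH zH] [Lx Ly Lz]] sp]]]] := sH L.
have [b bxyz [bp bq]] := spread_far2 genS ff (g ^+ k) (g^-1 ^+ k) sp.
have [bH Lb] : b \in H /\ (L <= len b)%N.
  by move: bxyz; rewrite !inE => /or3P[] /eqP ->.
have {}bp : 4 * a <= d b (g ^+ k) by lra.
have {}bq : 4 * a <= d b (g^-1 ^+ k) by lra.
suff [g' [gH' [e [m [h [hH [e_gt0 lg1 lh hg hgV]]]]]]] : exists g', g' \in H /\
    exists e m h, h \in H /\
    [/\ 0 < e, loxodromic S f e (g' ^+ m.+1)%g, loxodromic S f e h,
        distinct_ends S f h (g' ^+ m.+1)%g & distinct_ends S f h (g' ^+ m.+1)^-1].
  by apply: spread_of_loxodromics lg1 lh hg hgV => //; exact: gpredXn.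
have [bVp|bVp] := leP (2 * a) (d b^-1 (g ^+ k)).
  have [e [m hm]] := loxodromic_conjugate genS ff e00 a0 lg cauchy LP Lb bp bq bVp.
  exists g; split => //; exists e, m, ((g ^+ m.+1) ^ b^-1)%g; split => //.
  by apply: gpredJ; [exact: gpredXn|rewrite gpredV].
have bVq : 2 * a <= d b^-1 (g^-1 ^+ k).
  have := lg (n0 + n1)%N (n0 + n1)%N; rewrite -/k.
  by have := dtri b^-1 (g ^+ k) (g^-1 ^+ k); rewrite (dsym _ b^-1); lra.
have cauchyV m n : (k <= m)%N -> (k <= n)%N ->
    d (g^-1 ^+ m) (g^-1 ^+ n) <= a /\ d (g^-1^-1 ^+ m) (g^-1^-1 ^+ n) <= a.
  by move=> km kn; rewrite invgK; have [] := cauchy m n km kn.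
have bp' : 4 * a <= d b (g^-1^-1 ^+ k) by rewrite invgK.
have [e [m hm]] := loxodromic_conjugate genS ff e00 a0 lgV cauchyV LP Lb bq bp' bVq.
exists g^-1%g; split; first by rewrite gpredV.
exists e, m, ((g^-1 ^+ m.+1) ^ b^-1)%g; split => //.
by apply: gpredJ; [apply: gpredXn|]; rewrite gpredV.
Qed.

Lemma spread_stable_length (H : groupClosed G) : has_spread S f H ->
  exists (F : {fset G}) (C : R), [/\ {subset F <= H}, 0 < C &
    {in H, forall g, exists2 h, h \in F &
      (len (h * g))%:R - stable_length R S (h * g) <= C}].
Proof.
move=> /spread_inverses[e e0 sH]; have e80 : 0 < e / 8 by rewrite divr_gt0.
have [L LP] := floyd_dist_contraction genS ff e80.
have [C CP] := word_length_sub_stable_length genS ff e80.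
have [x [y [z [[[xH yH zH] [Lx Ly Lz]] [xy xz yz] spV]]]] := sH L.
exists [fset x; y; z]%fset, (C + L + len x + len y + len z).+1%:R; split => //.
  by move=> u; rewrite !inE => /orP[/orP[]|] /eqP ->.
move=> g gH; have [gL|Lg] := ltnP (len g) L.
  exists x; first by rewrite !inE eqxx.
  have : 0 <= stable_length R S (x * g)%g.
    by apply: stable_length_ge => // n; rewrite mul0r.
  have : (len (x * g))%:R <= (C + L + len x + len y + len z).+1%:R :> R.
    by rewrite ler_nat; have := word_lengthM genS x g; lia.
  lra.
have good u v : (L <= len u)%N -> (L <= len v)%N -> e <= d u v ->
    e / 2 <= d u^-1 g -> e / 2 <= d v^-1 g -> exists2 h, h = u \/ h = v &
    e / 8 <= d (h * g) (h * g)^-1.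
  move=> Lu Lv uv ug vg.
  have close w : (L <= len w)%N -> e / 2 <= d w^-1 g ->
      d w (w * g) <= e / 8 /\ d g^-1 (w * g)^-1 <= e / 8.
    move=> Lw wg; split; first by apply: LP => //; lra.
    rewrite invgM; apply: LP; first by rewrite (word_lengthV genS).
    by rewrite invgK dsym; lra.
  have [u1 u2] := close u Lu ug; have [v1 v2] := close v Lv vg.
  (* If [u] fails, then [u] is within [3 * e / 8] of [g^-1], so [v] is more than [5 * e / 8] from
     it; replacing [v] by [v * g] and [g^-1] by [(v * g)^-1] costs [e / 4]. *)
  have [hu|hu] := leP (e / 8) (d (u * g) (u * g)^-1); first by exists u; [left|].
  exists v; first by right.
  have := dtri g^-1 u v.
  have := dtri (u * g) u g^-1; have := dtri (u * g)^-1 (u * g) g^-1.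
  have := dtri (v * g) v g^-1; have := dtri (v * g)^-1 (v * g) g^-1.
  by rewrite (dsym g^-1 v) (dsym (u * g)^-1) (dsym (v * g)^-1); lra.
suff [h hF hg] : exists2 h, h \in [fset x; y; z]%fset &
    e / 8 <= d (h * g) (h * g)^-1.
  exists h => //; apply: le_trans (CP _ hg) _; rewrite ler_nat.
  by rewrite -!addnA leqW ?leq_addr.
case: (spread_far genS ff g spV) => -[h1 h2].
- by have [h [->|->] hP] := good _ _ Lx Ly xy h1 h2;
    [exists x|exists y]; rewrite // !inE eqxx ?orbT.
- by have [h [->|->] hP] := good _ _ Lx Lz xz h1 h2;
    [exists x|exists z]; rewrite // !inE eqxx ?orbT.
- by have [h [->|->] hP] := good _ _ Ly Lz yz h1 h2;
    [exists y|exists z]; rewrite // !inE eqxx ?orbT.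
Qed.

End SpreadInverses.

(** * Limit sets *)

Lemma card_ge3 (T : Type) (A : set T) : (`I_3 #<= A)%card ->
  exists x y z, [/\ A x, A y & A z] /\ [/\ x <> y, x <> z & y <> z].
Proof.
move=> /card_leP[g].
have lt3 i : (i < 3)%N -> i \in `I_3 by move=> ?; exact: mem_set.
pose a i (i3 : (i < 3)%N) := g (SigSub (lt3 i i3)).
have a_inj i j i3 j3 : i <> j -> val (@a i i3) <> val (@a j j3).
  move=> ij /val_inj aij; apply: ij.
  by have := 'inj_g (in_setT _) (in_setT _) aij => /(congr1 val).
exists (val (@a 0%N isT)), (val (@a 1%N isT)), (val (@a 2%N isT)).
by split; split; [exact: set_valP..|exact: a_inj|exact: a_inj|exact: a_inj].
Qed.

Section LimitSet.
Context {R : realType} {G : groupType} {S : {fset G}} {f : nat -> R}.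
Hypotheses (genS : generates S) (ff : floyd_function f).
Local Notation len := (word_length S).
Local Notation to := (to_floyd_completion genS ff).

(** A word ball is finite, so its image is closed and misses the boundary point [xi]; near [xi] the
    sequence takes only long values. *)
Lemma limit_set_approx H xi e n : limit_set genS ff H xi -> 0 < e ->
  exists a, [/\ a \in H, (n <= len a)%N & mdist xi (to a) < e].
Proof.
move=> [xi_bd [u uH clu]] e0.
pose B := to @` [set x | (len x <= n)%N].
have clB : closed B.
  apply: (accessible_finite_set_closed.1 _).
    exact/hausdorff_accessible/metric_hausdorff.
  by apply: finite_image; exact: finite_word_ball.
have nB : nbhs xi (ball xi e `&` ~` B).
  apply: filterI; first exact: nbhsx_ballx.
  apply: open_nbhs_nbhs; split; first by rewrite openC.
  by move=> [x _ xxi]; apply: xi_bd; exists x.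
have [|_ [[k _ <-] [+ kB]]] := clu (range (to \o u)) _ _ nB.
  by exists 0%N => // k _; exists k.
rewrite ballEmdist => /= ek; exists (u k); split => //.
by rewrite leqNgt; apply/negP => kn; apply: kB; exists (u k) => //=; exact: ltnW.
Qed.

(** With [e] a third of the least mutual distance, approximating both ends of a pair to within [e]
    leaves at least [e]. *)
Lemma limit_set_spread H : (`I_3 #<= limit_set genS ff H)%card ->
  has_spread S f H.
Proof.
have real_far (e vw vs sw st tw : R) : vw <= vs + sw -> sw <= st + tw ->
    vs < e -> tw < e -> e <= vw / 3 -> e <= st by lra.
move=> /card_ge3[x [y [z [[xH yH zH] [xy xz yz]]]]].
have pos (v w : floyd_completion genS ff) : v <> w -> 0 < mdist v w.
  move=> vw; rewrite lt_neqAle mdist_ge0 andbT; apply/eqP => vw0.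
  by apply: vw; exact/mdist_positivity.
have [e e0 [exy exz eyz]] : exists2 e : R, 0 < e &
    [/\ e <= mdist x y / 3, e <= mdist x z / 3 & e <= mdist y z / 3].
  move: (pos _ _ xy) (pos _ _ xz) (pos _ _ yz).
  move: (mdist x y) (mdist x z) (mdist y z) => p q r p0 q0 r0.
  exists (Num.min p (Num.min q r) / 3); first by rewrite divr_gt0// !lt_min p0 q0.
  by rewrite !ler_pM2r ?invr_gt0// !ge_min !lexx !orbT.
exists e; [exact: e0|move=> n].
have [a [aH La xa]] := limit_set_approx n xH e0.
have [b [bH Lb yb]] := limit_set_approx n yH e0.
have [c [cH Lc zc]] := limit_set_approx n zH e0.
exists a, b, c; split; first by split.
have far v w s t : mdist v (to s) < e -> mdist w (to t) < e ->
    e <= mdist v w / 3 -> e <= floyd_dist S f s t.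
  move=> vs wt evw.
  have -> : floyd_dist S f s t = mdist (to s) (to t).
    by apply/esym; exact: mdist_to_completion.
  apply: real_far (metric_triangle v (to s) w) (metric_triangle _ (to t) _) vs _ evw.
  by rewrite metric_sym.
by split; [exact: far xa yb exy|exact: far xa zc exz|exact: far yb zc eyz].
Qed.

(** A Cauchy sequence representing [xi] converges to [xi]. *)
Lemma floyd_boundary_sub_limit_set (H : {pred G}) : (forall g, g \in H) ->
  floyd_boundary genS ff `<=` limit_set genS ff H.
Proof.
move=> HT xi xi_bd; split => //; exists (sval (repr xi)) => //.
move=> A B FA nB; have := @cvg_to_completion _ _ (repr xi).
rewrite reprK => /(_ _ nB) FB.
exact: (@filter_ex _ _ _ _ (filterI FA FB)).
Qed.

End LimitSet.

(** * The whole group as a subgroup of itself *)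

Section FullSubgroup.
Variable G : groupType.

Definition full_subgroup : {pred G} := predT.

Let full_subgroupV : invg_closed full_subgroup. Proof. by []. Qed.
Let full_subgroup1 : 1%g \in full_subgroup. Proof. by []. Qed.
Let full_subgroupM : mulg_closed full_subgroup. Proof. by []. Qed.

HB.instance Definition _ := isMulClosed.Build G full_subgroup full_subgroupM.
HB.instance Definition _ := isMul1Closed.Build G full_subgroup full_subgroup1.
HB.instance Definition _ := isInvClosed.Build G full_subgroup full_subgroupV.

End FullSubgroup.

Arguments full_subgroup : clear implicits.

Theorem theorem1p7 (R : realType) (G : groupType) (S : {fset G})
    (genS : generates S) (f : nat -> R) (ff : floyd_function f)
    (nontrivial : (`I_3 #<= floyd_boundary genS ff)%card) :
  (forall H : groupClosed G,
     torsion_free H ->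
     (`I_3 #<= limit_set genS ff H)%card ->
     exists (F : {fset G}) (C : R),
       [/\ {subset F <= H}, 0 < C &
           {in H, forall g, exists2 h, h \in F &
              (word_length S (h * g)%g)%:R - stable_length R S (h * g)%g <= C}])
  /\ (virtually_torsion_free G -> strong_property_U R S).
Proof.
split=> [H _ /limit_set_spread|_]; first exact: spread_stable_length.
have sub : floyd_boundary genS ff `<=` limit_set genS ff (full_subgroup G).
  exact: floyd_boundary_sub_limit_set.
have /limit_set_spread hs : (`I_3 #<= limit_set genS ff (full_subgroup G))%card.
  by apply: card_le_trans nontrivial _; exact: subset_card_le.
have [F [C [_ C0 FC]]] := spread_stable_length genS ff hs.
pose M := (\max_(w <- F) word_length S w)%N.
(* Undoing the factor [w] costs at most [M], the largest length in [F], so the multiplicative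
   constant can be 1. *)
exists F, (C + M%:R), 1; split=> [||g]; rewrite ?ltr_pwDl//.
have [w wF wg] := FC g isT; exists w => //.
have : (word_length S g)%:R <= M%:R + (word_length S (w * g))%:R :> R.
  rewrite -natrD ler_nat; have := word_lengthM genS w^-1 (w * g).
  rewrite mulKg (word_lengthV genS) => /leq_trans; apply.
  by rewrite leq_add2r /M (big_rem w wF) leq_maxl.
by rewrite mul1r; lra.
Qed.
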